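(* Let $\omega,k\in\mathbb{R}$ with $k\neq 0$, $\omega+k\bar v\neq 0$ and $(\omega+k\bar v)^2\neq k^2(\bar c^2-\bar u^2)$, and let the damping parameter $\sigma\ge 0$ be constant in $x$. Consider the coupled problem in which the Fourier-transformed linearized Euler system $\hat A W_l=0$, $W_l=(p_l,u_l,v_l)^T$, is posed in $x<0$ and the second (extended) PML model $\hat{\mathcal A}^{pml2}W_r=0$, $W_r=(\mathcal P_r,p_r,u_r,v_r)^T$, is posed in $x>0$. The Euler solution is the general one, $$W_l(x)=\sum_{i=1}^{3}\alpha_i W_i e^{\lambda_i x},\qquad \alpha_1,\alpha_2,\alpha_3\in\mathbb{C},$$ and $W_r$ is a general solution of the PML system without the mode that grows as $x\to+\infty$, i.e. $W_r$ solves $\hat{\mathcal A}^{pml2}W_r=0$ and has the form $$W_r(x)=V_1e^{\lambda_1 x}+V_2e^{\lambda_2^{pml}x},\qquad V_1,V_2\in\mathbb{C}^4.$$ Suppose that at $x=0$ the following interface conditions hold: $$\mathcal P_r=0,\qquad p_l=p_r,\qquad \partial_x p_l=\partial_x^{pml}p_r,\qquad u_l=u_r.$$ Then $\alpha_3=0$, i.e. for any given incoming amplitudes $\alpha_1,\alpha_2$ there is no wave reflected into the Euler medium at the interface between the Euler medium and the infinite PML medium.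
   Context: Constants: $\bar\rho>0$, $\bar c>0$, and a constant subsonic flow $(\bar u,\bar v)\in\mathbb{R}^2$, $\bar u^2+\bar v^2<\bar c^2$, with $\bar u\ne 0$. Write $s=i\omega+ik\bar v$. All operators below are ordinary differential operators in $x$ with constant coefficients (obtained by Fourier transform in $t$ and $y$, with dual variables $\omega$ and $k$), acting on functions of $x$. Transport operator: $\hat{\mathcal G}=s+\bar u\,\partial_x$. Advective wave operator: $\hat{\mathcal L}=s^2+2\bar u s\,\partial_x+\bar c^2k^2-(\bar c^2-\bar u^2)\partial_{xx}$. Euler operator, acting on $(p,u,v)^T$: $$\hat A=\begin{pmatrix}\hat{\mathcal G}&\bar\rho\bar c^2\partial_x& i\bar\rho\bar c^2k\\ \frac1{\bar\rho}\partial_x&\hat{\mathcal G}&0\\ \frac{ik}{\bar\rho}&0&\hat{\mathcal G}\end{pmatrix}.$$ Exponents: $\lambda_1=-s/\bar u$ (the root of $\hat{\mathcal G}e^{\lambda x}=0$), and $\lambda_2,\lambda_3$ are the two roots of $\hat{\mathcal L}e^{\lambda x}=0$: $$\lambda_{2}=\frac{\bar u s-\bar c\,r}{\bar c^2-\bar u^2},\quad \lambda_3=\frac{\bar u s+\bar c\,r}{\bar c^2-\bar u^2},$$ where $r=s\sqrt{1-\frac{k^2(\bar c^2-\bar u^2)}{(\omega+k\bar v)^2}}$ if $|k|\sqrt{\bar c^2-\bar u^2}<|\omega+k\bar v|$, and $r=\sqrt{k^2(\bar c^2-\bar u^2)-(\omega+k\bar v)^2}$ if $|k|\sqrt{\bar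 c^2-\bar u^2}>|\omega+k\bar v|$. Euler modes: $W_i=e^{-\lambda_i x}F^{-1}(0,0,e^{\lambda_i x})^T\in\mathbb{C}^3$, $i=1,2,3$ (independent of $x$), where $$F=\begin{pmatrix}\frac{\hat{\mathcal G}}{ik\bar\rho\bar c^2}&\frac{\partial_x}{ik}&1\\ \frac{\partial_x}{\bar\rho\bar u}&\frac{\hat{\mathcal G}}{\bar u}&0\\ \frac{\bar u}{s}&\frac{\bar\rho\bar u^2}{s}&0\end{pmatrix},$$ whose determinant is a nonzero constant, so that $F^{-1}$ has entries polynomial in $\partial_x$; its $(1,3)$ entry is $(F^{-1})_{13}=\hat{\mathcal G}/\bar u$. (The matrix $F$ comes from the Smith factorization $\hat A=EDF$ with $D=\mathrm{diag}(1,1,\hat{\mathcal G}\hat{\mathcal L})$; the functions $W_ie^{\lambda_ix}$ span the solutions of $\hat AW=0$.) PML derivative: with $a=\dfrac{\bar c s}{\bar c s+(\bar c^2-\bar u^2)\sigma}$, $$\partial_x^{pml}=a\Big[\partial_x-\frac{\bar u s}{\bar c^2-\bar u^2}\Big]+\frac{\bar u s}{\bar c^2-\bar u^2}.$$ PML wave operator: $\hat{\mathcal L}^{pml}=s^2+2\bar u s\,\partial_x^{pml}+\bar c^2k^2-(\bar c^2-\bar u^2)(\partial_x^{pml})^2$. Second (extended) PML model, acting on $(\mathcal P,p,u,v)^T$: $$\hat{\mathcal A}^{pml2}=\begin{pmatrix}\hat{\mathcal G}&-1&0&0\\ \hat{\mathcal L}^{pml}-\hat{\mathcal L}&\hat{\mathcal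 G}&\bar\rho\bar c^2\partial_x&i\bar\rho\bar c^2k\\ 0&\frac1{\bar\rho}\partial_x&\hat{\mathcal G}&0\\ 0&\frac{ik}{\bar\rho}&0&\hat{\mathcal G}\end{pmatrix}.$$ PML exponents: the exponents of the solutions of $\hat{\mathcal A}^{pml2}W=0$ are $\lambda_1$ (with a two-dimensional space of vectors) and, for $i=2,3$, $$\lambda_i^{pml}=\Big(1+\frac{(\bar c^2-\bar u^2)\sigma}{\bar c s}\Big)\Big(\lambda_i-\frac{\bar u s}{\bar c^2-\bar u^2}\Big)+\frac{\bar u s}{\bar c^2-\bar u^2}.$$ *)

(* Defs.v *)
From HB Require Import structures.
From mathcomp Require Import all_boot all_order all_algebra.
From mathcomp Require Import complex.
From mathcomp Require Import all_classical all_reals all_analysis.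

Set Implicit Arguments.
Unset Strict Implicit.
Unset Printing Implicit Defensive.

Import Order.TTheory GRing.Theory Num.Theory.
Local Open Scope ring_scope.
Local Open Scope complex_scope.

Section ComplexValuedFunctions.
Variable R : realType.
Local Notation C := R[i].

Definition cexp (z : C) : C :=
  (expR (complex.Re z) * cos (complex.Im z))
  +i* (expR (complex.Re z) * sin (complex.Im z)).

(* The derivative of a complex-valued function of a real variable is taken on
   real and imaginary parts. Like [derive1] it is total: it is meaningful only
   where both parts are differentiable, which is the case for all the
   (combinations of exponentials) functions it is used on. *)
Definition cderive (f : R -> C) (x : R) : C :=
  derive1 (fun y => complex.Re (f y)) x
  +i* derive1 (fun y => complex.Im (f y)) x.

(* A constant-coefficient operator in d/dx is a polynomial whose indeterminate
   'X stands for d/dx; products of polynomials are compositions of operators. *)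
Definition opapp (P : {poly C}) (f : R -> C) (x : R) : C :=
  \sum_(j < size P) P`_j * iter j cderive f x.

Definition mxopapp m n (A : 'M[{poly C}]_(m, n)) (W : R -> 'cV[C]_n) (x : R) :
    'cV[C]_m :=
  \col_i \sum_j opapp (A i j) (fun y => W y j 0) x.

End ComplexValuedFunctions.

Definition mx_of_rows (T : nmodType) m n (rows : seq (seq T)) : 'M[T]_(m, n) :=
  \matrix_(i, j) (nth [::] rows i)`_j.

Section PML.
Variable R : realType.
Local Notation C := R[i].

(* rho, c, (u, v) : background density, sound speed and flow; w, k : dual
   variables of t and y; sigma : damping. *)
Variables (rho c u v w k sigma : R).

Definition sfreq : C := 'i * w%:C + 'i * (k * v)%:C.
Local Notation s := sfreq.

Definition Gop : {poly C} := s%:P + u%:C *: 'X.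

Definition Lop : {poly C} :=
  (s ^+ 2)%:P + (2 * u%:C * s) *: 'X + ((c ^+ 2 * k ^+ 2)%:C)%:P
  - (c ^+ 2 - u ^+ 2)%:C *: 'X^2.

Definition eulerOp : 'M[{poly C}]_3 := mx_of_rows 3 3
  [:: [:: Gop; (rho * c ^+ 2)%:C *: 'X; ('i * (rho * c ^+ 2 * k)%:C)%:P];
      [:: (rho^-1)%:C *: 'X; Gop; 0];
      [:: ('i * (k / rho)%:C)%:P; 0; Gop] ].

Definition rroot : C :=
  if `|k| * Num.sqrt (c ^+ 2 - u ^+ 2) < `|w + k * v|
  then s * (Num.sqrt (1 - k ^+ 2 * (c ^+ 2 - u ^+ 2) / (w + k * v) ^+ 2))%:C
  else (Num.sqrt (k ^+ 2 * (c ^+ 2 - u ^+ 2) - (w + k * v) ^+ 2))%:C.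

Definition lambda1 : C := - s / u%:C.
Definition lambda2 : C := (u%:C * s - c%:C * rroot) / (c ^+ 2 - u ^+ 2)%:C.
Definition lambda3 : C := (u%:C * s + c%:C * rroot) / (c ^+ 2 - u ^+ 2)%:C.

Definition Fop : 'M[{poly C}]_3 := mx_of_rows 3 3
  [:: [:: ('i * (k * rho * c ^+ 2)%:C)^-1 *: Gop; ('i * k%:C)^-1 *: 'X; 1];
      [:: ((rho * u)%:C)^-1 *: 'X; (u%:C)^-1 *: Gop; 0];
      [:: (u%:C / s)%:P; ((rho * u ^+ 2)%:C / s)%:P; 0] ].

(* When rho, c, u, k, s are nonzero, [\det Fop = -1], so Fop is a unit of the
   ring of polynomial matrices and [invmx] is its genuine inverse there; the
   value of [eulerMode lam x] then does not depend on x. *)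
Definition eulerMode (lam : C) (x : R) : 'cV[C]_3 :=
  cexp (- lam * x%:C) *:
    mxopapp (invmx Fop)
      (fun y => \col_i (if i == 2 :> 'I_3 then cexp (lam * y%:C) else 0)) x.

Definition apml : C :=
  (c%:C * s) / (c%:C * s + ((c ^+ 2 - u ^+ 2) * sigma)%:C).

Definition shiftpml : C := (u%:C * s) / (c ^+ 2 - u ^+ 2)%:C.

Definition Dpml : {poly C} := apml *: ('X - shiftpml%:P) + shiftpml%:P.

Definition Lpml : {poly C} :=
  (s ^+ 2)%:P + (2 * u%:C * s) *: Dpml + ((c ^+ 2 * k ^+ 2)%:C)%:P
  - (c ^+ 2 - u ^+ 2)%:C *: Dpml ^+ 2.

Definition pml2Op : 'M[{poly C}]_4 := mx_of_rows 4 4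
  [:: [:: Gop; -1; 0; 0];
      [:: Lpml - Lop; Gop; (rho * c ^+ 2)%:C *: 'X;
          ('i * (rho * c ^+ 2 * k)%:C)%:P];
      [:: 0; (rho^-1)%:C *: 'X; Gop; 0];
      [:: 0; ('i * (k / rho)%:C)%:P; 0; Gop] ].

Definition lambda_pml (lam : C) : C :=
  (1 + ((c ^+ 2 - u ^+ 2) * sigma)%:C / (c%:C * s)) * (lam - shiftpml)
  + shiftpml.

End PML.

(* Main.v *)
Require Import Defs.
From mathcomp Require Import all_boot all_order all_algebra.
From mathcomp Require Import complex.
From mathcomp Require Import all_classical all_reals all_analysis.
From mathcomp Require Import ring lra.

(* No Smith form is needed for the PML system. The first row of the extended
   model is [G P = p], and [G] kills [exp (lambda1 x)]; since [lambda1] differs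
   from the decaying PML exponent, the [p]-component of [V1] vanishes, and
   [p_r] is a single exponential. On it the PML derivative acts as
   multiplication by [lambda2]. On the Euler side the [p]-component of mode [i]
   is [G(lambda_i) / u], which vanishes for [i = 1]. Subtracting [lambda2] times
   the continuity of [p] from the continuity of its derivative leaves
   [alpha3 (lambda3 - lambda2) G(lambda3) / u = 0], where no factor but [alpha3]
   can vanish. *)

Set Implicit Arguments.
Unset Strict Implicit.
Unset Printing Implicit Defensive.

Import Order.TTheory GRing.Theory Num.Theory.
Local Open Scope ring_scope.
Local Open Scope complex_scope.

(** * Complex exponentials and the action of constant-coefficient operators on them *)

Section ComplexExponential.
Variable R : realType.
Local Notation C := R[i].
Implicit Types (z l m a b : C) (x y : R).

Lemma cexpD z z' : cexp (z + z') = cexp z * cexp z' :> C.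
Proof.
case: z z' => [p q] [p' q']; rewrite /cexp /= expRD cosD sinD.
apply/eqP; rewrite eq_complex /=; apply/andP; split; apply/eqP; ring.
Qed.

Lemma cexp0 : cexp 0 = 1 :> C.
Proof. by rewrite /cexp /= expR0 cos0 sin0 mulr1 mulr0. Qed.

Lemma cexp_neq0 z : cexp z != 0.
Proof.
apply/eqP => z0; have := cexpD z (- z).
by rewrite subrr cexp0 z0 mul0r => /eqP; rewrite oner_eq0.
Qed.

Lemma cexpNK z : cexp (- z) * cexp z = 1.
Proof. by rewrite -cexpD addNr cexp0. Qed.

(** The modulus at [x = 1] forces the real part of [l] to vanish; a nonzero imaginary part [q] would
    give the value -1 at [x = pi / |q|]. *)
Lemma cexp_rate_eq0 l : (forall x, 0 < x -> cexp (l * x%:C) = 1) -> l = 0.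
Proof.
case: l => p q h.
have p0 : p = 0.
  have /= := h 1 ltr01; rewrite /cexp /= => -[].
  rewrite !(mulr1, mulr0, subr0, add0r) => e1 e2.
  have : expR p ^+ 2 = 1.
    transitivity ((expR p * cos q) ^+ 2 + (expR p * sin q) ^+ 2).
      by rewrite !exprMn -mulrDr cos2Dsin2 mulr1.
    by rewrite e1 e2; ring.
  move/eqP; rewrite sqrp_eq1 ?expR_ge0// => /eqP.
  by rewrite -expR0 => /expR_inj.
move: h; rewrite p0 => h.
case: (eqVneq q 0) => [->//|q0].
have := h (pi / `|q|); rewrite divr_gt0 ?pi_gt0 ?normr_gt0// => /(_ isT).
rewrite /cexp /= => -[].
rewrite !(mul0r, mulr0, subr0, add0r, oppr0) expR0 mul1r.
move=> + _; have [qp|qn] := ger0P q.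
  by rewrite mulrCA divff// mulr1 cospi => ?; exfalso; lra.
by rewrite mulrCA invrN mulrN divff// mulrN1 cosN cospi => ?; exfalso; lra.
Qed.

(* [a * cexp ((l - m) * x%:C)] takes the same value at [x] and [x + x], hence
   [cexp ((l - m) * x%:C) = 1]. *)
Lemma cexp_indep l m a b : l != m ->
  (forall x, 0 < x -> a * cexp (l * x%:C) + b * cexp (m * x%:C) = 0) -> a = 0.
Proof.
move=> lm h; apply/eqP; apply: contraNT lm => a0.
rewrite -subr_eq0; apply/eqP; apply: cexp_rate_eq0 => x x0.
have H y : 0 < y -> a * cexp ((l - m) * y%:C) = - b.
  move=> y0; apply: (mulIf (cexp_neq0 (m * y%:C))).
  have -> : a * cexp ((l - m) * y%:C) * cexp (m * y%:C) = a * cexp (l * y%:C).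
    by rewrite -mulrA -cexpD mulrBl subrK.
  by apply/eqP; rewrite mulNr -addr_eq0 h.
have dbl : (l - m) * (x + x)%:C = (l - m) * x%:C + (l - m) * x%:C.
  by rewrite rmorphD mulrDr.
have := H _ (addr_gt0 x0 x0); rewrite dbl cexpD -(H _ x0) => /(mulfI a0) e.
by apply: (mulfI (cexp_neq0 ((l - m) * x%:C))); rewrite e mulr1.
Qed.

(** Relational form of [cderive] that also records differentiability, without which the total
    [cderive] has no sum or scaling rule. *)
Definition is_cderive (f : R -> C) x (d : C) : Prop :=
  is_derive x 1 (fun y => complex.Re (f y)) (complex.Re d) /\
  is_derive x 1 (fun y => complex.Im (f y)) (complex.Im d).

Lemma is_cderive_cexp l x :
  is_cderive (fun y => cexp (l * y%:C)) x (l * cexp (l * x%:C)).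
Proof.
case: l => p q.
have scaled_id (t z : R) : is_derive z 1 (fun y : R => t * y) t.
  rewrite -[X in is_derive _ _ _ X]mulr1.
  exact: (is_deriveZ t (is_derive_id z 1)).
have dexp : is_derive x 1 (fun y => expR (p * y)) (expR (p * x) * p).
  exact: is_derive1_comp.
have dcos : is_derive x 1 (fun y => cos (q * y)) (- sin (q * x) * q).
  exact: is_derive1_comp.
have dsin : is_derive x 1 (fun y => sin (q * y)) (cos (q * x) * q).
  exact: is_derive1_comp.
split => /=.
- rewrite (_ : (fun y => _) = (fun y => expR (p * y)) * (fun y => cos (q * y))).
    by apply: is_derive_eq; rewrite /GRing.scale/= !(mulr0, subr0, add0r); ring.
  by apply/funext => y /=; rewrite !(mulr0, subr0, add0r).
- rewrite (_ : (fun y => _) = (fun y => expR (p * y)) * (fun y => sin (q * y))).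
    by apply: is_derive_eq; rewrite /GRing.scale/= !(mulr0, subr0, add0r); ring.
  by apply/funext => y /=; rewrite !(mulr0, subr0, add0r).
Qed.

Lemma is_cderiveZ a (f : R -> C) x d :
  is_cderive f x d -> is_cderive (fun y => a * f y) x (a * d).
Proof.
case: a d => [p q] [d1 d2] [/= df dg]; split => /=.
- rewrite (_ : (fun y => _) = p *: (fun y => complex.Re (f y))
    - q *: (fun y => complex.Im (f y))); first exact: is_deriveB.
  by apply/funext => y; rewrite !fctE; case: (f y) => f1 f2.
- rewrite (_ : (fun y => _) = p *: (fun y => complex.Im (f y))
    + q *: (fun y => complex.Re (f y))); first exact: is_deriveD.
  by apply/funext => y; rewrite !fctE; case: (f y) => f1 f2.
Qed.

Lemma is_cderiveD (f g : R -> C) x d e :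
  is_cderive f x d -> is_cderive g x e ->
  is_cderive (fun y => f y + g y) x (d + e).
Proof.
case: d e => [d1 d2] [e1 e2] [/= df1 df2] [/= dg1 dg2]; split => /=.
- rewrite (_ : (fun y => _) = (fun y => complex.Re (f y))
    + (fun y => complex.Re (g y))); first exact: is_deriveD.
  by apply/funext => y; rewrite raddfD.
- rewrite (_ : (fun y => _) = (fun y => complex.Im (f y))
    + (fun y => complex.Im (g y))); first exact: is_deriveD.
  by apply/funext => y; rewrite raddfD.
Qed.

Lemma is_cderiveE (f : R -> C) x d : is_cderive f x d -> cderive f x = d.
Proof.
by case: d => d1 d2 [/= df dg]; rewrite /cderive !derive1E !derive_val.
Qed.

Lemma cderive_cexp2 a l b m :
  cderive (fun y => a * cexp (l * y%:C) + b * cexp (m * y%:C)) =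
  (fun y => a * l * cexp (l * y%:C) + b * m * cexp (m * y%:C)).
Proof.
apply/funext => x; rewrite -!mulrA.
by apply/is_cderiveE/is_cderiveD; apply/is_cderiveZ/is_cderive_cexp.
Qed.

(** Each derivative multiplies [exp (l y)] by [l], so the operator acts through its symbol [P.[l]].
    Two terms suffice: [p_l] and every component of [W_r] have this shape. *)
Lemma opapp_cexp2 (P : {poly C}) a l b m x :
  opapp P (fun y => a * cexp (l * y%:C) + b * cexp (m * y%:C)) x =
  a * P.[l] * cexp (l * x%:C) + b * P.[m] * cexp (m * x%:C).
Proof.
have iterE j : iter j (@cderive R)
    (fun y => a * cexp (l * y%:C) + b * cexp (m * y%:C)) =
    (fun y => a * l ^+ j * cexp (l * y%:C) + b * m ^+ j * cexp (m * y%:C)).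
  elim: j => [|j /= ->]; first by rewrite !expr0 !mulr1.
  by rewrite cderive_cexp2 -!mulrA -!exprSr.
rewrite /opapp !horner_coef !mulr_sumr !mulr_suml -big_split/=.
by apply: eq_bigr => j _; rewrite iterE; ring.
Qed.

Lemma opapp_cexp (P : {poly C}) l x :
  opapp P (fun y => cexp (l * y%:C)) x = P.[l] * cexp (l * x%:C).
Proof.
rewrite [X in opapp P X](_ : _ =
  (fun y => 1 * cexp (l * y%:C) + 0 * cexp (l * y%:C))).
  by rewrite opapp_cexp2 !mul0r addr0 mul1r.
by apply/funext => y; rewrite mul1r mul0r addr0.
Qed.

Lemma opapp0f (P : {poly C}) x : opapp P (fun=> 0) x = 0.
Proof.
rewrite [X in opapp P X](_ : _ =
  (fun y => 0 * cexp (0 * y%:C) + 0 * cexp (0 * y%:C))).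
  by rewrite opapp_cexp2 !mul0r addr0.
by apply/funext => y; rewrite !mul0r addr0.
Qed.

End ComplexExponential.

Lemma realC_neq0 (R : realType) (t : R) : t != 0 -> t%:C != 0.
Proof. by rewrite eq_complex /= eqxx andbT. Qed.

(** * Symbols at the Euler and PML exponents, and the Euler modes *)

Section PMLAlgebra.
Variables (R : realType) (rho c u v w k sigma : R).
Local Notation C := R[i].
Hypotheses (rho_gt0 : 0 < rho) (c_gt0 : 0 < c) (u_neq0 : u != 0).
Hypotheses (u_lt_c : u ^+ 2 < c ^+ 2) (k_neq0 : k != 0).
Hypotheses (wkv_neq0 : w + k * v != 0).
Hypothesis nonglancing : (w + k * v) ^+ 2 != k ^+ 2 * (c ^+ 2 - u ^+ 2).

Local Notation s := (sfreq v w k).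
Local Notation r := (rroot c u v w k).
Local Notation G := (Gop u v w k).
Local Notation l1 := (lambda1 u v w k).
Local Notation l2 := (lambda2 c u v w k).
Local Notation l3 := (lambda3 c u v w k).
Local Notation mu := (lambda_pml c u v w k sigma l2).

Let b_gt0 : 0 < c ^+ 2 - u ^+ 2. Proof. by rewrite subr_gt0. Qed.

Lemma sfreqE : s = 0 +i* (w + k * v).
Proof.
by apply/eqP; rewrite eq_complex /sfreq /=; apply/andP; split; apply/eqP; ring.
Qed.

Lemma sfreq_neq0 : s != 0.
Proof. by rewrite sfreqE eq_complex /= eqxx. Qed.

(* The first alternative is the propagating regime, the second the evanescent
   one. *)
Lemma rroot_cases :
  (exists2 q : R, 0 < q < 1 & r = s * q%:C) \/ (exists2 q : R, 0 < q & r = q%:C).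
Proof.
have th2_gt0 : 0 < (w + k * v) ^+ 2 by rewrite exprn_even_gt0.
have kb_gt0 : 0 < k ^+ 2 * (c ^+ 2 - u ^+ 2).
  by rewrite mulr_gt0// exprn_even_gt0.
have E : (`|k| * Num.sqrt (c ^+ 2 - u ^+ 2) < `|w + k * v|) =
    (k ^+ 2 * (c ^+ 2 - u ^+ 2) < (w + k * v) ^+ 2).
  rewrite -sqrtr_sqr -sqrtrM ?sqr_ge0// -[`|w + _|]sqrtr_sqr.
  by rewrite ltr_sqrt.
rewrite /rroot E; case: ltP => h.
- left; eexists; last reflexivity.
  rewrite sqrtr_gt0 subr_gt0 ltr_pdivrMr// mul1r h /=.
  by rewrite -[ltRHS]sqrtr1 ltr_sqrt// gtrBl divr_gt0.
- right; eexists; last reflexivity.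
  by rewrite sqrtr_gt0 subr_gt0 lt_neqAle nonglancing.
Qed.

Lemma rroot_neq0 : r != 0.
Proof.
case: rroot_cases => [[q /andP[q0 _] ->]|[q q0 ->]].
  by rewrite mulf_neq0 ?sfreq_neq0// realC_neq0 ?gt_eqF.
by rewrite realC_neq0 ?gt_eqF.
Qed.

Lemma Gop_horner l : G.[l] = s + u%:C * l.
Proof. by rewrite /Gop !hornerE. Qed.

Lemma Gop_lambda1 : G.[l1] = 0.
Proof.
by rewrite Gop_horner /lambda1; field; exact: realC_neq0.
Qed.

(** Subsonic flow and [q < 1] give [(u q)^2 < c^2]. The product of propositions lets either half
    serve as a rewrite rule. *)
Let speed_neq0 (q : R) : 0 < q < 1 -> (c + u * q != 0) * (c - u * q != 0).
Proof.
move=> /andP[q0 q1].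
have q2 : (u * q) ^+ 2 < c ^+ 2.
  apply: le_lt_trans u_lt_c.
  by rewrite exprMn ler_piMr ?sqr_ge0// expr_le1// ltW.
by split; apply: contraTneq q2 => ?; rewrite -leNgt; nra.
Qed.

(** Up to a nonzero factor the value is [c s + u r]. If propagating, this is [s (c + u q)]; if
    evanescent, [u r] is real and the imaginary part is [c (w + k v)]. *)
Lemma Gop_lambda3_neq0 : G.[l3] != 0.
Proof.
have bC := realC_neq0 (lt0r_neq0 b_gt0).
have -> : G.[l3] = c%:C / (c ^+ 2 - u ^+ 2)%:C * (c%:C * s + u%:C * r).
  rewrite Gop_horner /lambda3; field.
  by move: bC; rewrite rmorphB !rmorphXn.
have cC := realC_neq0 (lt0r_neq0 c_gt0).
rewrite mulf_neq0 ?mulf_neq0 ?invr_neq0//.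
case: rroot_cases => [[q q01 ->]|[q q0 ->]].
  have -> : c%:C * s + u%:C * (s * q%:C) = s * (c + u * q)%:C by ring.
  by rewrite mulf_neq0 ?sfreq_neq0// realC_neq0// speed_neq0.
rewrite sfreqE eq_complex /= negb_and; apply/orP; right.
rewrite !(mul0r, mulr0, addr0).
by rewrite mulf_neq0// gt_eqF.
Qed.

(** It is enough that [G] does not vanish at the PML exponent. If propagating, [r / s] is real, so
    damping leaves the nonzero imaginary part unchanged. *)
Lemma lambda1_neq_lambda_pml2 : l1 != mu.
Proof.
apply/eqP => /(congr1 (horner G)) /esym; rewrite Gop_lambda1 => /eqP; apply/negP.
have bC := realC_neq0 (lt0r_neq0 b_gt0).
have cC := realC_neq0 (lt0r_neq0 c_gt0).
have -> : G.[mu] = (c / (c ^+ 2 - u ^+ 2))%:C * (c%:C * s - u%:C * r)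
    - (u * sigma)%:C * (r / s).
  rewrite Gop_horner /lambda_pml /lambda2 /shiftpml; field.
  by rewrite sfreq_neq0 cC andbT; move: bC; rewrite rmorphB !rmorphXn.
case: rroot_cases => [[q q01 ->]|[q q0 ->]].
  rewrite [s * _ / s]mulrAC divff ?sfreq_neq0// mul1r.
  have -> : c%:C * s - u%:C * (s * q%:C) = s * (c - u * q)%:C by ring.
  rewrite sfreqE eq_complex /= negb_and; apply/orP; right.
  rewrite !(mul0r, mulr0, addr0, oppr0, add0r, subr0).
  by rewrite !mulf_neq0 ?invr_neq0 ?speed_neq0// gt_eqF.
(* Evanescent case: the factor [s] makes the damping term real, and [s^2] is real too, so only the
   term [u q s] contributes to the imaginary part. *)
apply/eqP => /(congr1 (fun z => complex.Im (s * z))).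
have -> : s * ((c / (c ^+ 2 - u ^+ 2))%:C * (c%:C * s - u%:C * q%:C)
  - (u * sigma)%:C * (q%:C / s)) =
  (c / (c ^+ 2 - u ^+ 2))%:C * (c%:C * (s * s) - (u * q)%:C * s)
  - (u * sigma * q)%:C.
  by field; rewrite sfreq_neq0 ?andbT /=; move: bC; rewrite rmorphB !rmorphXn.
rewrite mulr0 sfreqE /= !(mul0r, mulr0, addr0, oppr0, add0r, subr0).
apply/eqP; rewrite mulrN oppr_eq0.
by rewrite !mulf_neq0 ?invr_neq0 ?(gt_eqF c_gt0) ?(gt_eqF b_gt0) ?(gt_eqF q0).
Qed.

Lemma lambda3_sub_lambda2_neq0 : l3 - l2 != 0.
Proof.
have bC := realC_neq0 (lt0r_neq0 b_gt0).
have cC := realC_neq0 (lt0r_neq0 c_gt0).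
have -> : l3 - l2 = 2 * c%:C / (c ^+ 2 - u ^+ 2)%:C * r.
  rewrite /lambda3 /lambda2; field.
  by move: bC; rewrite rmorphB !rmorphXn.
by rewrite !mulf_neq0 ?invr_neq0 ?rroot_neq0// pnatr_eq0.
Qed.

(** The stretching factor in [lambda_pml] is the inverse of [apml], whose denominator has imaginary
    part [c (w + k v)]. *)
Lemma Dpml_lambda_pml l :
  (Dpml c u v w k sigma).[lambda_pml c u v w k sigma l] = l.
Proof.
have bC := realC_neq0 (lt0r_neq0 b_gt0).
have cC := realC_neq0 (lt0r_neq0 c_gt0).
have den : c%:C * s + ((c ^+ 2 - u ^+ 2) * sigma)%:C != 0.
  rewrite sfreqE eq_complex /= negb_and; apply/orP; right.
  by rewrite !(mul0r, mulr0, addr0, add0r) mulf_neq0// gt_eqF.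
rewrite /Dpml !hornerE /lambda_pml /apml.
set sh := shiftpml _ _ _ _ _; set d := (_ * sigma)%:C in den *.
field; rewrite sfreq_neq0 cC /=.
by move: den; rewrite /d rmorphM rmorphB !rmorphXn.
Qed.

(** The negated adjugate of [Fop], whose determinant is -1. *)
Definition Fop_inv : 'M[{poly C}]_3 := mx_of_rows 3 3
  [:: [:: 0; (- (rho * u ^+ 2)%:C / s)%:P; (u%:C)^-1 *: G];
      [:: 0; (u%:C / s)%:P; - ((rho * u)%:C^-1 *: 'X)];
      [:: 1; ('i * (k * rho * c ^+ 2)%:C)^-1 *: G * ((rho * u ^+ 2)%:C / s)%:P
             - ('i * k%:C)^-1 *: 'X * (u%:C / s)%:P;
             ('i * k%:C)^-1 *: 'X * ((rho * u)%:C^-1 *: 'X)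
             - ('i * (k * rho * c ^+ 2)%:C)^-1 *: G * ((u%:C)^-1 *: G)] ].

Lemma Fop_mulV : Fop rho c u v w k *m Fop_inv = 1%:M.
Proof.
have uC := realC_neq0 u_neq0; have rhoC := realC_neq0 (lt0r_neq0 rho_gt0).
apply/matrixP => i j; rewrite !mxE.
rewrite !big_ord_recl big_ord0 !mxE /=.
case: i => [[|[|[|//]]] ?]; case: j => [[|[|[|//]]] ?] /=.
all: rewrite /Gop -?mul_polyC; try ring.
(* The two remaining goals are the second and third diagonal entries. They need cancellation of
   scalar inverses, so they are sorted into a coefficient of ['X], which is 0, and a constant, which
   is 1. *)
- transitivity (((rho * u)%:C^-1 * (- (rho * u ^+ 2)%:C / s)
    + u%:C^-1 * u%:C * (u%:C / s))%:P * 'X + (u%:C^-1 * s * (u%:C / s))%:P).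
    ring.
  rewrite [X in X%:P * 'X](_ : _ = 0) ?[X in _ + X%:P](_ : _ = 1).
  + by rewrite mul0r add0r.
  + by field; rewrite uC sfreq_neq0.
  + by field; rewrite rhoC uC sfreq_neq0.
- transitivity ((u%:C / s * u%:C^-1 * u%:C
    - (rho * u ^+ 2)%:C / s * (rho * u)%:C^-1)%:P * 'X
      + (u%:C / s * u%:C^-1 * s)%:P).
    ring.
  rewrite [X in X%:P * 'X](_ : _ = 0) ?[X in _ + X%:P](_ : _ = 1).
  + by rewrite mul0r add0r.
  + by field; rewrite uC sfreq_neq0.
  + by field; rewrite rhoC uC sfreq_neq0.
Qed.

Lemma invmx_Fop : invmx (Fop rho c u v w k) = Fop_inv.
Proof.
have [FU _] := mulmx1_unit Fop_mulV.
by rewrite -[LHS]mulmx1 -Fop_mulV mulKmx.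
Qed.

(** Only the top right entry [G / u] of the inverse meets the nonzero component of the vector, and
    the prefactor cancels the exponential. *)
Lemma eulerMode_p l x : eulerMode rho c u v w k l x 0 0 = G.[l] / u%:C.
Proof.
rewrite /eulerMode invmx_Fop !mxE !big_ord_recl big_ord0 /=.
rewrite addr0.
have colE (j : 'I_3) :
    (fun y : R => (\col_(i < 3) (if i == 2 then cexp (l * y%:C) else 0)) j 0) =
    (fun y : R => if j == 2 then cexp (l * y%:C) else 0).
  by apply/funext => y; rewrite mxE.
rewrite !colE /= !opapp0f !add0r opapp_cexp !mxE /=.
by rewrite hornerZ mulrCA mulNr cexpNK mulr1 mulrC.
Qed.

End PMLAlgebra.

(** * The interface problem *)

Theorem mainTheorem2 (R : realType) (rho c u v w k sigma : R)
  (rho_gt0 : 0 < rho) (c_gt0 : 0 < c)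
  (subsonic : u ^+ 2 + v ^+ 2 < c ^+ 2) (u_neq0 : u != 0)
  (k_neq0 : k != 0) (wkv_neq0 : w + k * v != 0)
  (nonglancing : (w + k * v) ^+ 2 != k ^+ 2 * (c ^+ 2 - u ^+ 2))
  (sigma_ge0 : 0 <= sigma)
  (Wl : R -> 'cV[R[i]]_3) (Wr : R -> 'cV[R[i]]_4)
  (alpha1 alpha2 alpha3 : R[i]) (V1 V2 : 'cV[R[i]]_4)
  (Wl_solves : forall x, x < 0 -> mxopapp (eulerOp rho c u v w k) Wl x = 0)
  (Wr_solves : forall x, 0 < x ->
     mxopapp (pml2Op rho c u v w k sigma) Wr x = 0)
  (Wl_general : let mode lam x :=
       cexp (lam * x%:C) *: eulerMode rho c u v w k lam x in
     forall x, Wl x = alpha1 *: mode (lambda1 u v w k) x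
                    + alpha2 *: mode (lambda2 c u v w k) x
                    + alpha3 *: mode (lambda3 c u v w k) x)
  (Wr_general : forall x,
     Wr x = cexp (lambda1 u v w k * x%:C) *: V1
          + cexp (lambda_pml c u v w k sigma (lambda2 c u v w k) * x%:C) *: V2)
  (* components of Wl: 0 = p, 1 = u; components of Wr: 0 = P, 1 = p, 2 = u *)
  (interface_P : Wr 0 0 0 = 0)
  (interface_p : Wl 0 0 0 = Wr 0 1 0)
  (interface_dp : cderive (fun x => Wl x 0 0) 0
                  = opapp (Dpml c u v w k sigma) (fun x => Wr x 1 0) 0)
  (interface_u : Wl 0 1 0 = Wr 0 2 0) :
  alpha3 = 0.
Proof.
have u_lt_c : u ^+ 2 < c ^+ 2.
  by apply: le_lt_trans subsonic; rewrite lerDl sqr_ge0.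
set l1 := lambda1 _ _ _ _ in Wl_general Wr_general.
set l2 := lambda2 _ _ _ _ _ in Wl_general Wr_general.
set l3 := lambda3 _ _ _ _ _ in Wl_general.
set mu := lambda_pml _ _ _ _ _ _ _ in Wr_general.
set G := Gop u v w k.
have pl x : Wl x 0 0 = alpha2 * (G.[l2] / u%:C) * cexp (l2 * x%:C)
    + alpha3 * (G.[l3] / u%:C) * cexp (l3 * x%:C).
  have M l := eulerMode_p c rho_gt0 u_neq0 wkv_neq0 l x.
  rewrite Wl_general; move: (M l1) (M l2) (M l3).
  (* The modes are generalized so that [mxE] does not unfold them; only their [p]-components are
     kept. *)
  move: (eulerMode _ _ _ _ _ _ l1 x) (eulerMode _ _ _ _ _ _ l2 x)
    (eulerMode _ _ _ _ _ _ l3 x) => m1 m2 m3 e1 e2 e3.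
  by rewrite !mxE e1 e2 e3 Gop_lambda1//; ring.
have Wr_comp i x : Wr x i 0 = V1 i 0 * cexp (l1 * x%:C)
    + V2 i 0 * cexp (mu * x%:C).
  by rewrite Wr_general !mxE; congr (_ + _); exact: mulrC.
have Wr_fun i : (fun x => Wr x i 0) = (fun x => V1 i 0 * cexp (l1 * x%:C)
    + V2 i 0 * cexp (mu * x%:C)) by apply/funext => x.
have V1p : V1 1 0 = 0.
  (* [b] is the coefficient of [exp (mu x)] in [p - G P]; that of [exp (l1 x)] is [V1 1 0] alone,
     since [G.[l1] = 0]. *)
  apply: (cexp_indep (m := mu) (l := l1) (b := V2 1 0 - G.[mu] * V2 ord0 0)).
    exact: lambda1_neq_lambda_pml2.
  move=> x x0; have /matrixP/(_ 0 0) := Wr_solves x x0.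
  rewrite !mxE !big_ord_recl big_ord0 !mxE /= !Wr_fun !opapp_cexp2.
  have hornerN1 z : (- 1 : {poly R[i]}).[z] = - 1 by rewrite hornerN hornerC.
  rewrite Gop_lambda1// !hornerN1 !horner0.
  rewrite (_ : lift ord0 ord0 = 1); last exact/val_inj.
  by move/(congr1 -%R); rewrite oppr0 => <-; rewrite /G; ring.
have pl_fun := funext pl.
move: interface_p interface_dp.
rewrite pl !Wr_comp Wr_fun pl_fun.
rewrite cderive_cexp2 opapp_cexp2 !V1p Dpml_lambda_pml//.
(* Continuity of [p] eliminates [V2 1 0]. The [alpha2] terms then carry the factor [l2] on both
   sides and cancel. *)
rewrite !mulr0 cexp0 !mulr1 !mul0r !add0r => <- /eqP.
rewrite -subr_eq0.
rewrite (_ : _ - _ = alpha3 * (G.[l3] / u%:C * (l3 - l2))); last by ring.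
rewrite mulf_eq0 => /orP[/eqP//|]; apply: contraTeq => _.
by rewrite !mulf_neq0 ?invr_neq0 ?realC_neq0 ?Gop_lambda3_neq0
  ?lambda3_sub_lambda2_neq0.
Qed.
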